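(* Consider invariant subsets $\mathbb{X},\mathbb{Y}\subset\mathbb{R}^d$ with continuous-time flows $S_t^{(1)}$ (on $\mathbb{X}$) and $S_t^{(2)}$ (on $\mathbb{Y}$) that are topologically orbit equivalent by $h:\mathbb{X}\to\mathbb{Y}$, and suppose that each has Koopman eigenfunctions, $g^{(1)}_{\lambda_i}(x)$ and $g^{(2)}_{\lambda_i}(y)$ respectively, with (nonzero, real) eigenvalues $\lambda_i$, $i=1,\dots,d$. The eigenfunctions are organized in two (column) vector-valued functions $$\mathcal{G}^{(1)}(x)=[g^{(1)}_{\lambda_1}(x),g^{(1)}_{\lambda_2}(x),\dots,g^{(1)}_{\lambda_d}(x)]^T,\qquad \mathcal{G}^{(2)}(y)=[g^{(2)}_{\lambda_1}(y),g^{(2)}_{\lambda_2}(y),\dots,g^{(2)}_{\lambda_d}(y)]^T,$$ consisting of $d$ matching pairs of eigenfunctions, each pair associated to its own eigenvalue $\lambda_i=\lambda_i^{(1)}=\lambda_i^{(2)}$, and related by the same homeomorphism $h$, that is, $g^{(1)}_{\lambda_i}(x)=g^{(2)}_{\lambda_i}\circ h(x)$ for $i=1,\dots,d$. Assume that the function $\mathcal{G}^{(2)}:\mathbb{R}^d\to\mathbb{R}^d$ is invertible in an open set around a point $y\in\mathbb{Y}$. Equivalently, one can assume that the Jacobian of $\mathcal{G}^{(2)}$ is nonsingular at the point $y$, so that there is an open set $A\subset\mathbb{X}$ with $x\in A$ such that $y=h(x)$ is defined for all $x\in A$. In this case, $(\mathcal{G}^{(1)},\mathcal{G}^{(2)})$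 is called a complete set of eigenfunctions, and, together with the relation by $h$, a componentwise matched complete set of eigenfunctions. Furthermore, when $\mathcal{G}^{(2),-1}$ (the inverse of $\mathcal{G}^{(2)}$) exists, the transformation between the spaces may be written $$y=h(x)=\mathcal{G}^{(2),-1}\circ\mathcal{G}^{(1)}(x).$$ The degree of regularity of this transformation follows that of the vector-valued functions $\mathcal{G}^{(j)}$, $j=1,2$.
   Context: Two flows (or semiflows) $S_t^{(1)}:\mathbb{X}\to\mathbb{X}$ and $S_t^{(2)}:\mathbb{Y}\to\mathbb{Y}$ are called topologically orbit equivalent by $h$ if $h:\mathbb{X}\to\mathbb{Y}$ is a homeomorphism with $S_t^{(2)}(h(x))=h(S_t^{(1)}(x))$ for every $t\in\mathbb{R}$ (for every $t\ge 0$ in the case of semiflows). The Koopman operator of a flow $S_t$ acts on observables $g$ (in general complex-valued functions on the state space, taken from a chosen function space) by $\mathcal{K}_t[g](x)=g\circ S_t(x)$. A Koopman eigenfunction with eigenvalue $\lambda$ is an observable $g$ with $\mathcal{K}_t[g](x)=e^{\lambda t}g(x)$.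
   Formalization: The Jacobian condition assumes the second eigenfunction map is C^1 near y and is equivalent to having a C^1 local inverse; regularity means C^r (r up to infinity), with h inheriting it if the inverse is C^r or the Jacobian is nonsingular. *)

(* Defs.v *)
From HB Require Import structures.
From mathcomp Require Import all_boot all_order all_algebra.
From mathcomp Require Import all_classical all_reals all_analysis.
Set Implicit Arguments.
Unset Strict Implicit.
Unset Printing Implicit Defensive.
Import Order.TTheory GRing.Theory Num.Theory.
Import numFieldNormedType.Exports.
Local Open Scope classical_set_scope.
Local Open Scope ring_scope.

Section Koopman.
Context {R : realType} {d : nat}.
Local Notation E := 'rV[R]_d.

(* Points of R^d are row vectors, the convention of the library's Jacobian.
   Maps on subsets of R^d are total functions on R^d, of which only the values
   on the subset are constrained. *)

(* A one-parameter group of self-maps of X; in particular X is invariant under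
   every [S t]. No continuity in (t, x) is required. *)
Definition flow_on (X : set E) (S : R -> E -> E) : Prop :=
  [/\ forall t x, X x -> X (S t x),
      forall x, X x -> S 0 x = x
    & forall s t x, X x -> S (s + t) x = S s (S t x)].

Definition homeomorphism_between (X Y : set E) (h : E -> E) : Prop :=
  exists k : E -> E,
    [/\ (forall x, X x -> Y (h x)) /\ (forall y, Y y -> X (k y)),
        forall x, X x -> k (h x) = x,
        forall y, Y y -> h (k y) = y,
        {within X, continuous h}
      & {within Y, continuous k}].

Definition orbit_equivalent (X Y : set E) (S1 S2 : R -> E -> E) (h : E -> E) :
    Prop :=
  homeomorphism_between X Y h /\
  forall t x, X x -> S2 t (h x) = h (S1 t x).

Definition koopman (S : R -> E -> E) (t : R) (g : E -> R) : E -> R := g \o S t.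

Definition koopman_eigenfunction (X : set E) (S : R -> E -> E) (lam : R)
    (g : E -> R) : Prop :=
  forall t x, X x -> koopman S t g x = expR (lam * t) * g x.

Definition vector_valued (g : 'I_d -> E -> R) : E -> E :=
  fun x => \row_i g i x.

Definition local_inverse (U : set E) (G Ginv : E -> E) : Prop :=
  forall u, U u -> Ginv (G u) = u.

Definition invertible_around (G : E -> E) (y : E) : Prop :=
  exists U Ginv, open_nbhs y U /\ local_inverse U G Ginv.

Definition complete_set (X Y : set E) (S1 S2 : R -> E -> E) (lam : 'I_d -> R)
    (g1 g2 : 'I_d -> E -> R) (y : E) : Prop :=
  [/\ forall i, koopman_eigenfunction X S1 (lam i) (g1 i),
      forall i, koopman_eigenfunction Y S2 (lam i) (g2 i)
    & invertible_around (vector_valued g2) y].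

Definition componentwise_matched (X : set E) (h : E -> E)
    (g1 g2 : 'I_d -> E -> R) : Prop :=
  forall i x, X x -> g1 i x = (g2 i \o h) x.

Definition componentwise_matched_complete_set (X Y : set E)
    (S1 S2 : R -> E -> E) (h : E -> E) (lam : 'I_d -> R)
    (g1 g2 : 'I_d -> E -> R) (y : E) : Prop :=
  complete_set X Y S1 S2 lam g1 g2 y /\ componentwise_matched X h g1 g2.

(* C^n on an open set W, by induction on the order. *)
Fixpoint Cn (n : nat) (W : set E) (f : E -> E) : Prop :=
  match n with
  | 0%N => forall x, W x -> {for x, continuous f}
  | n'.+1 => (forall x, W x -> differentiable f x) /\
             (forall v : E, Cn n' W ('D_v f))
  end.

(* [Some n] is the class C^n, [None] the class C^oo. *)
Definition Cr_open (r : option nat) (W : set E) (f : E -> E) : Prop :=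
  match r with
  | Some n => Cn n W f
  | None => forall n, Cn n W f
  end.

(* Regularity on an arbitrary subset D of R^d: continuity for the subspace
   topology when r = 0, and otherwise local extendability to a C^r map of an
   open set of R^d; the latter is the usual notion when D is open. *)
Definition Cr_on (r : option nat) (D : set E) (f : E -> E) : Prop :=
  match r with
  | Some 0%N => {within D, continuous f}
  | _ => forall x, D x -> exists W F,
      [/\ open_nbhs x W, Cr_open r W F & forall z, D z -> W z -> F z = f z]
  end.

(* The Jacobian hypothesis presupposes that G is C^1 near y. *)
Definition jacobian_nonsingular_at (G : E -> E) (y : E) : Prop :=
  (exists V, open_nbhs y V /\ Cr_open (Some 1%N) V G) /\ 'J G y \in unitmx.

(* A is an open subset of X containing a point over y, and on A the map h is
   Ginv \o G1, where Ginv is only evaluated in its range of validity G2 @` U. *)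
Definition inverse_formula_on (X : set E) (h G1 G2 : E -> E) (y : E)
    (U : set E) (Ginv : E -> E) (A : set E) : Prop :=
  [/\ exists2 O : set E, open O & A = X `&` O,
      exists2 x, A x & y = h x
    & forall x, A x ->
        [/\ U (h x), (G2 @` U) (G1 x) & h x = (Ginv \o G1) x]].

End Koopman.

(* Main.v *)
Require Import Defs.
From HB Require Import structures.
From mathcomp Require Import all_boot all_order all_algebra.
From mathcomp Require Import all_classical all_reals all_analysis.
From mathcomp Require Import ring lra.
Set Implicit Arguments.
Unset Strict Implicit.
Unset Printing Implicit Defensive.
Import Order.TTheory GRing.Theory Num.Theory.
Import numFieldNormedType.Exports.
Local Open Scope classical_set_scope.
Local Open Scope ring_scope.

(** The eigenfunctions matter only through the matching relation: it says
    G1 = G2 o h on X, so that on the part of X which h sends into the domain of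
    a local inverse Ginv of G2, necessarily h = Ginv o G1.  That part is
    relatively open because h is continuous, and it contains the point over y
    because h is onto ([inverse_formula]).  The regularity of h is then that of
    a composition ([Cr_on_comp]).

    Everything else is the inverse function theorem in R^d, including the
    statement that the inverse is as smooth as the map itself, and its easy
    converse, the chain rule ([jacobian_unit_of_left_inverse]).

    For the existence of the inverse, let M be the inverse of the Jacobian of f
    at y.  The map p(x) = x - f(x) M has zero derivative at y, hence a
    derivative of norm at most 1/2 on a ball around y
    ([near_small_derivative]); by the mean value inequality p is
    1/2-Lipschitz there.  Since x = p(x) + f(x) M, distances in the ball are
    controlled by distances between values of f, which gives injectivity and a
    Lipschitz inverse at once; and solving f(x) = z amounts to finding a fixed
    point of the contraction x |-> p(x) + z M, which gives openness of the image
    ([inverse_function]).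

    For its regularity, the inverse g has derivative
    v |-> v (J f (g z))^-1 at z ([is_diff_inverse]).  By Cramer's rule the
    entries of an inverse matrix are rational functions of the entries of the
    matrix, so if g is C^n and f is C^(n+1) this derivative is C^n and g is
    C^(n+1) ([Ck_local_inverse]).  This induction, which starts from the mere
    continuity of g, needs that C^n maps are stable under products, inverses
    and composition.  Since the same g serves for all n, the domain of the
    inverse does not depend on the order of regularity, and C^oo comes for
    free. *)

(** * Matrices and differentials in the sup norm *)

Lemma coord_norm_le (R : realType) n (x : 'rV[R]_n) j : `|x 0 j| <= `|x|.
Proof.
by rewrite [leRHS]/Num.Def.normr/= mx_normrE; apply: (le_bigmax _ _ (0, j)).
Qed.

Lemma row_norm_le (R : realType) n (x : 'rV[R]_n) (c : R) :
  0 <= c -> (forall j, `|x 0 j| <= c) -> `|x| <= c.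
Proof.
move=> c0 xc; rewrite /Num.Def.normr/= mx_normrE bigmax_le//= => -[i j] _.
by rewrite ord1.
Qed.

Lemma mulmx_norm_le (R : realType) m n (M : 'M[R]_(m, n)) (v : 'rV_m) :
  `|v *m M| <= (\sum_i \sum_j `|M i j|) * `|v|.
Proof.
apply: row_norm_le => [|j].
  by rewrite mulr_ge0// sumr_ge0// => i _; rewrite sumr_ge0.
rewrite mxE (le_trans (ler_norm_sum _ _ _))// mulr_suml ler_sum// => i _.
rewrite normrM mulrC ler_pM ?coord_norm_le//.
by rewrite (bigD1 j)//= lerDl sumr_ge0.
Qed.

Lemma mulmx_bound (R : realType) m n (M : 'M[R]_(m, n)) :
  exists2 k : R, 0 < k & forall v : 'rV_m, `|v *m M| <= k * `|v|.
Proof.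
exists (1 + \sum_i \sum_j `|M i j|) => [|v].
  by rewrite ltr_pwDl// sumr_ge0// => i _; rewrite sumr_ge0.
by rewrite (le_trans (mulmx_norm_le _ _))// mulrDl mul1r lerDr.
Qed.

Lemma continuous_mulmxr (R : realType) m n (M : 'M[R]_(m, n)) :
  continuous (mulmxr M : 'rV_m -> 'rV_n).
Proof.
apply/linear_bounded_continuous/linear_boundedP.
have [k _ Mk] := mulmx_bound M.
near=> r => v /=; rewrite (le_trans (Mk v))// ler_wpM2r//.
Unshelve. all: end_near. Qed.

(** The library phrases differentiability through Landau symbols; proofs that
    combine several estimates are shorter with an explicit epsilon. *)
Lemma is_diff_epsilon (R : realType) (V W : normedModType R) (f : V -> W)
    (L : {linear V -> W}) (a : V) :
  continuous L ->
  (forall e : R, 0 < e ->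
     \forall x \near a, `|f x - f a - L (x - a)| <= e * `|x - a|) ->
  is_diff a f L.
Proof.
move=> Lc fL.
have fLo : f \o shift a = cst (f a) + L +o_ 0 id.
  apply/eqaddoP => e e0; have := fL e e0; rewrite (near_shift 0)/=.
  by apply: filterS => h /=; rewrite subr0 addrK !fctE opprD addrA.
have dfL := diff_unique Lc fLo.
by split => //; apply/diff_locallyP; rewrite dfL.
Qed.

Lemma differentiable_epsilon (R : realType) (V W : normedModType R) (f : V -> W)
    (a : V) (e : R) : differentiable f a -> 0 < e ->
  \forall x \near a, `|f x - f a - 'd f a (x - a)| <= e * `|x - a|.
Proof.
move=> /diff_locallyP[_ /eqaddoP/(_ e)] + e0 => /(_ e0).
rewrite [X in _ -> X](near_shift 0)/=.
by apply: filterS => h /=; rewrite subr0 addrK !fctE opprD addrA.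
Qed.

Lemma near_eq_differentiable (R : realType) (V W : normedModType R)
    (f g : V -> W) (a : V) :
  {near a, f =1 g} -> differentiable f a -> differentiable g a.
Proof.
move=> fg df; have fga := nbhs_singleton fg.
suff: is_diff a g ('d f a) by case.
apply: is_diff_epsilon => [|e e0]; first exact: diff_continuous.
near=> x; rewrite -(near fg x)// -fga.
by near: x; exact: differentiable_epsilon.
Unshelve. all: by end_near. Qed.

Lemma is_derive_line (R : realType) (V W : normedModType R) (f : V -> W)
    (a v : V) (t : R) : derivable f (a + t *: v) v ->
  is_derive t (1 : R) (fun s : R => f (a + s *: v)) ('D_v f (a + t *: v)).
Proof.
rewrite /derivable => df.
have E : (fun h : R => h^-1 *: (((fun s : R => f (a + s *: v)) \o shift t)
    (h *: (1 : R)) - f (a + t *: v))) =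
    (fun h => h^-1 *: ((f \o shift (a + t *: v)) (h *: v) - f (a + t *: v))).
  by apply/funext => h /=; rewrite [h *: 1]mulr1 scalerDl addrCA.
by split; rewrite /derivable /derive E.
Qed.

(** The mean value theorem fails for vector-valued maps, but for the sup norm
    the inequality only needs the scalar theorem, one coordinate at a time. *)
Lemma mean_value_inequality (R : realType) (V : normedModType R) n
    (p : V -> 'rV[R]_n) (a b : V) (c : R) :
  (forall t : R, 0 <= t <= 1 ->
     differentiable p (a + t *: (b - a)) /\
     `|'D_(b - a) p (a + t *: (b - a))| <= c) ->
  `|p b - p a| <= c.
Proof.
move=> pc.
have c0 : 0 <= c.
  by have [//|_ /(le_trans _)->] := pc 0; rewrite ?lexx ?ler01.
apply: row_norm_le => // j.
pose q (t : R) := p (a + t *: (b - a)) 0 j.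
have dq (t : R) : 0 <= t <= 1 ->
    is_derive t (1 : R) q ('D_(b - a) p (a + t *: (b - a)) 0 j).
  move=> /pc[/diff_derivable dp _]; rewrite derive_mx// mxE.
  apply: (is_derive_line (f := fun x => p x 0 j)).
  exact: (derivable_mxP _ _ _).1.
have [t t01] : exists2 t, t \in `]0, 1[%R & q 1 - q 0 =
    'D_(b - a) p (a + t *: (b - a)) 0 j * (1 - 0).
  apply: (@MVT R q (fun t => 'D_(b - a) p (a + t *: (b - a)) 0 j)) => //.
    by move=> t; rewrite in_itv/= => /andP[t0 t1]; apply: dq; rewrite !ltW.
  apply: derivable_within_continuous => t; rewrite in_itv/= => /dq dqt.
  exact: ex_derive.
rewrite subr0 mulr1 /q scale1r scale0r addr0 subrKC => Eq.
rewrite !mxE Eq; apply: le_trans (coord_norm_le _ _) _.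
by have [|//] := pc t; move: t01; rewrite in_itv/= => /andP[? ?]; rewrite !ltW.
Qed.

(** * Calculus of C^n maps *)

Section Ck_def.
Context {R : realType} {V F : normedModType R}.

(** [Cn] for an arbitrary codomain: the regularity of an inverse map is read
    off the entries of a Jacobian, which are scalar functions. *)
Fixpoint Ck (n : nat) (W : set V) (f : V -> F) : Prop :=
  match n with
  | 0%N => forall x, W x -> {for x, continuous f}
  | n'.+1 => (forall x, W x -> differentiable f x) /\
             (forall v : V, Ck n' W ('D_v f))
  end.

End Ck_def.

Section Ck.
Context {R : realType} {V : normedModType R}.
Implicit Types F : normedModType R.

Lemma Ck_sub F n (W W' : set V) (f : V -> F) :
  W' `<=` W -> Ck n W f -> Ck n W' f.
Proof.
move=> WW'; elim: n f => [|n IHn] f /=; first by move=> cf x /WW'; exact: cf.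
by move=> [df Cf]; split => [x /WW' /df//|v]; exact: IHn.
Qed.

Lemma CkS F n (W : set V) (f : V -> F) : Ck n.+1 W f -> Ck n W f.
Proof.
elim: n f => [|n IHn] f [df Cf]; last by split => // v; exact: IHn.
by move=> x /df /differentiable_continuous.
Qed.

Lemma Ck_continuous F n (W : set V) (f : V -> F) :
  Ck n W f -> forall x, W x -> {for x, continuous f}.
Proof. by elim: n => [//|n IHn] /CkS. Qed.

(** The operators ['D_v] are only computed inside the open set [W], whereas the
    recursion in [Ck] speaks of total functions; this lemma bridges the gap. *)
Lemma Ck_eq F n (W : set V) (f g : V -> F) :
  open W -> (forall x, W x -> f x = g x) -> Ck n W f -> Ck n W g.
Proof.
move=> oW; elim: n f g => [|n IHn] f g fg /=.
  move=> cf x Wx; have fgx : {near x, f =1 g}.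
    by near=> y; apply: fg; near: y; exact: open_nbhs_nbhs.
  rewrite /prop_for /continuous_at -fg//.
  by apply: cvg_trans (cf x Wx); apply: near_eq_cvg; apply: filterS fgx.
have fgx x : W x -> {near x, f =1 g}.
  by move=> Wx; near=> y; apply: fg; near: y; exact: open_nbhs_nbhs.
move=> [df Cf]; split => [x Wx|v].
  apply: near_eq_differentiable (df x Wx); exact: fgx.
apply: IHn (Cf v) => x /fgx fgx'; exact: near_eq_derive.
Unshelve. all: by end_near. Qed.

Lemma Ck_cst F n (W : set V) (c : F) : Ck n W (cst c).
Proof.
elim: n c => [|n IHn] c /=; first by move=> x _; exact: cst_continuous.
split=> [x _|v]; first exact: differentiable_cst.
rewrite (_ : 'D_v _ = cst 0)//.
by apply/funext => x; rewrite derive_cst.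
Qed.

Section open.
Variables (W : set V) (oW : open W).

Lemma CkD F n (f g : V -> F) :
  Ck n W f -> Ck n W g -> Ck n W (fun x => f x + g x).
Proof.
elim: n f g => [|n IHn] f g /= Cf Cg.
  by move=> x Wx; apply: continuousD; [exact: Cf|exact: Cg].
case: Cf Cg => [df Cf] [dg Cg]; split=> [x Wx|v].
  by apply: differentiableD; [exact: df|exact: dg].
apply: Ck_eq (IHn _ _ (Cf v) (Cg v)) => // x Wx.
by rewrite [RHS]deriveD//; apply: diff_derivable; [exact: df|exact: dg].
Qed.

Lemma CkM n (f g : V -> R) :
  Ck n W f -> Ck n W g -> Ck n W (fun x => f x * g x).
Proof.
elim: n f g => [|n IHn] f g Cf Cg.
  by move=> x Wx; apply: continuousM; [exact: Cf|exact: Cg].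
have [Cf' Cg'] := (CkS Cf, CkS Cg).
case: Cf Cg => [df Cf] [dg Cg]; split=> [x Wx|v].
  by apply: differentiableM; [exact: df|exact: dg].
have := CkD (IHn _ _ Cf' (Cg v)) (IHn _ _ Cg' (Cf v)); apply: Ck_eq => // x Wx.
by rewrite [RHS]deriveM//; apply: diff_derivable; [exact: df|exact: dg].
Qed.

Lemma CkZl F n (f : V -> R) (c : F) : Ck n W f -> Ck n W (fun x => f x *: c).
Proof.
elim: n f => [|n IHn] f /=.
  move=> cf x Wx; apply: (@continuous_comp _ _ _ f ( *:%R^~ c)).
    exact: cf.
  exact: scalel_continuous.
move=> [df Cf]; split=> [x Wx|v]; first exact/differentiableZl/df.
apply: Ck_eq (IHn _ (Cf v)) => // x Wx.
have dfx := df _ Wx.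
by rewrite !deriveE ?diffZl//; exact: differentiableZl.
Qed.

Lemma CkV n (f : V -> R) : (forall x, W x -> f x != 0) ->
  Ck n W f -> Ck n W (fun x => (f x)^-1).
Proof.
move=> f0; elim: n => [|n IHn] Cf.
  by move=> x Wx; apply: continuousV; [exact: f0|exact: Cf].
have CVf := IHn (CkS Cf).
case: Cf => [df Cf]; split=> [x Wx|v].
  by apply: differentiableV; [exact: df|exact: f0].
have := CkM (Ck_cst n W (-1 : R)) (CkM (CkM CVf CVf) (Cf v)).
apply: Ck_eq => // x Wx.
rewrite [RHS]deriveV; [|exact: f0|exact/diff_derivable/df].
by rewrite -expr2 -exprVn /GRing.scale/= mulN1r mulNr.
Qed.

Lemma Ck_sum F n (I : Type) (s : seq I) (P : pred I) (f : I -> V -> F) :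
  (forall i, P i -> Ck n W (f i)) ->
  Ck n W (fun x => \sum_(i <- s | P i) f i x).
Proof.
move=> Cf; elim: s => [|i s IHs].
  apply: Ck_eq (Ck_cst n W (0 : F)) => // x _.
  by rewrite big_nil.
have [Pi|Pi] := boolP (P i).
  apply: Ck_eq (CkD (Cf i Pi) IHs) => // x _.
  by rewrite big_cons Pi.
apply: Ck_eq IHs => // x _.
by rewrite big_cons (negbTE Pi).
Qed.

Lemma Ck_prod n (I : Type) (s : seq I) (P : pred I) (f : I -> V -> R) :
  (forall i, P i -> Ck n W (f i)) ->
  Ck n W (fun x => \prod_(i <- s | P i) f i x).
Proof.
move=> Cf; elim: s => [|i s IHs].
  apply: Ck_eq (Ck_cst n W (1 : R)) => // x _.
  by rewrite big_nil.
have [Pi|Pi] := boolP (P i).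
  apply: Ck_eq (CkM (Cf i Pi) IHs) => // x _.
  by rewrite big_cons Pi.
apply: Ck_eq IHs => // x _.
by rewrite big_cons (negbTE Pi).
Qed.

Lemma Ck_det n m (A : V -> 'M[R]_m) :
  (forall i j, Ck n W (fun x => A x i j)) -> Ck n W (fun x => \det (A x)).
Proof.
move=> CA; apply: Ck_sum => s _; apply: CkM; first exact: Ck_cst.
exact: Ck_prod.
Qed.

(** Cramer's rule. *)
Lemma Ck_invmx n m (A : V -> 'M[R]_m) :
  (forall x, W x -> A x \in unitmx) ->
  (forall i j, Ck n W (fun x => A x i j)) ->
  forall i j, Ck n W (fun x => invmx (A x) i j).
Proof.
move=> uA CA i j.
have C1 : Ck n W (fun x => (\det (A x))^-1).
  by apply: CkV (Ck_det CA) => x /uA; rewrite unitmxE unitfE.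
have C2 : Ck n W (fun x => (-1) ^+ (j + i) * \det (row' j (col' i (A x)))).
  apply: CkM; first exact: Ck_cst.
  apply: Ck_det => k l; apply: Ck_eq (CA (lift j k) (lift i l)) => // x _.
  by rewrite !mxE.
apply: Ck_eq (CkM C1 C2) => // x Wx.
by rewrite /invmx uA// !mxE.
Qed.

(** Only products of scalar functions have been differentiated so far; this
    reduces row-valued maps to their coordinates. *)
Lemma Ck_row n m (f : V -> 'rV[R]_m) :
  (forall j, Ck n W (fun x => f x 0 j)) -> Ck n W f.
Proof.
move=> Cf.
have := @Ck_sum 'rV[R]_m n _ (index_enum 'I_m) xpredT
  (fun j x => f x 0 j *: delta_mx 0 j).
move=> /(_ (fun j _ => CkZl _ (Cf j))).
by apply: Ck_eq => // x _; rewrite -row_sum_delta.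
Qed.

Lemma Ck_coord n m (f : V -> 'rV[R]_m) j :
  Ck n W f -> Ck n W (fun x => f x 0 j).
Proof.
elim: n f => [|n IHn] f /=.
  move=> cf x Wx; apply: (continuous_comp (g := fun M : 'rV_m => M 0 j)).
    exact: cf.
  exact: coord_continuous.
move=> [df Cf]; split=> [x Wx|v].
  apply: (differentiable_comp (g := fun M : 'rV_m => M 0 j)); first exact: df.
  exact: differentiable_coord.
apply: Ck_eq (IHn _ (Cf v)) => // x Wx.
by rewrite derive_mx ?mxE//; exact/diff_derivable/df.
Qed.

End open.
End Ck.

Lemma derive_row (R : realType) m (W : normedModType R) (g : 'rV[R]_m -> W)
    (a v : 'rV[R]_m) : differentiable g a ->
  'D_v g a = \sum_j v 0 j *: 'D_(delta_mx 0 j) g a.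
Proof.
move=> dg; rewrite deriveE// [in LHS](row_sum_delta v) linear_sum/=.
by apply: eq_bigr => j _; rewrite linearZ/= deriveE.
Qed.

(** By the chain rule, the derivative of [g \o f] is a sum of products of a
    coordinate of ['D_v f] and a partial derivative of [g] composed with [f];
    the induction is on the order, for all [g] at once. *)
Lemma Ck_comp_scalar (R : realType) (V : normedModType R) m n
    (W : set V) (W' : set 'rV[R]_m) (f : V -> 'rV[R]_m) (g : 'rV[R]_m -> R) :
  open W -> (forall x, W x -> W' (f x)) ->
  Ck n W f -> Ck n W' g -> Ck n W (g \o f).
Proof.
move=> oW WW'; elim: n g => [|n IHn] g Cf Cg.
  by move=> x Wx; apply: continuous_comp; [exact: Cf|exact/Cg/WW'].
have Cf' := CkS Cf.
case: Cf Cg => df Df [dg Dg]; split=> [x Wx|v].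
  by apply: differentiable_comp; [exact: df|exact/dg/WW'].
have := @Ck_sum R V W oW R n _ (index_enum 'I_m) xpredT
  (fun j x => 'D_v f x 0 j * ('D_(delta_mx 0 j) g \o f) x).
move=> /(_ (fun j _ => CkM oW (Ck_coord oW j (Df v)) (IHn _ Cf' (Dg _)))).
apply: Ck_eq => // x Wx; have [dfx dgx] := (df x Wx, dg _ (WW' _ Wx)).
have -> : 'D_v (g \o f) x = 'D_('D_v f x) g (f x).
  have -> := deriveE v (differentiable_comp dfx dgx).
  by rewrite (diff_comp dfx dgx)/= -(deriveE v dfx) -(deriveE _ dgx).
by rewrite (derive_row _ dgx); apply: eq_bigr => j _.
Qed.

Lemma Ck_comp (R : realType) (V : normedModType R) m l n
    (W : set V) (W' : set 'rV[R]_m) (f : V -> 'rV[R]_m)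
    (g : 'rV[R]_m -> 'rV[R]_l) :
  open W -> open W' -> (forall x, W x -> W' (f x)) ->
  Ck n W f -> Ck n W' g -> Ck n W (g \o f).
Proof.
move=> oW oW' WW' Cf Cg; apply: Ck_row => // j.
by have := Ck_comp_scalar oW WW' Cf (Ck_coord oW' j Cg).
Qed.

Lemma jacobian_coord (R : realType) m l (f : 'rV[R]_m -> 'rV[R]_l) a i j :
  differentiable f a -> ('J f a) i j = 'D_(delta_mx 0 i) f a 0 j.
Proof. by move=> df; rewrite mxE deriveE. Qed.

Lemma Ck_jacobian (R : realType) m l n (W : set 'rV[R]_m)
    (f : 'rV[R]_m -> 'rV[R]_l) i j :
  open W -> Ck n.+1 W f -> Ck n W (fun x => ('J f x) i j).
Proof.
move=> oW [df Cf]; apply: Ck_eq (Ck_coord oW j (Cf (delta_mx 0 i))) => // x Wx.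
by rewrite jacobian_coord//; exact: df.
Qed.

(** * The inverse function theorem *)

(** With [x = g z], the error in the linear approximation of [g] at [f a] is,
    up to sign, the error for [f] at [a] multiplied by [invmx ('J f a)], and
    [x - a] is of the order of [z - f a] by the Lipschitz hypothesis. *)
Lemma is_diff_inverse (R : realType) d (U : set 'rV[R]_d)
    (f g : 'rV[R]_d -> 'rV[R]_d) (c : R) (a : 'rV[R]_d) :
  open (f @` U) -> (forall x, U x -> g (f x) = x) -> 0 < c ->
  (forall x x', U x -> U x' -> `|x - x'| <= c * `|f x - f x'|) ->
  U a -> differentiable f a -> 'J f a \in unitmx ->
  is_diff (f a) g (mulmxr (invmx ('J f a))).
Proof.
move=> oV gf c0 fc Ua df uJ; set M := invmx _.
have [k k0 Mk] := mulmx_bound M.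
have Vfa : nbhs (f a) (f @` U) by apply: open_nbhs_nbhs; split => //; exists a.
apply: is_diff_epsilon => [|e e0]; first exact: continuous_mulmxr.
(* [k] is lost when multiplying by [M], and [c] in passing from [x - a] to
   [z - f a]. *)
have ek0 : 0 < e / (k * c) by rewrite divr_gt0// mulr_gt0.
have /nbhs_ballP[r r0 fr] := differentiable_epsilon df ek0.
near=> z; have [x Ux fx] : (f @` U) z by near: z.
have /(fr _) : ball a r x.
  rewrite -ball_normE/= (le_lt_trans (fc _ _ Ua Ux))// -ltr_pdivlMl// fx.
  near: z; apply: (@cvgr_dist_lt _ _ _ (nbhs (f a)) _ id) => //.
  by rewrite mulr_gt0// invr_gt0.
rewrite -fx !gf//= => fxa.
have -> : x - a - (f x - f a) *m M = - (f x - f a - 'd f a (x - a)) *m M.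
  have {1}-> : x - a = 'd f a (x - a) *m M.
    by rewrite -(deriveE _ df) (deriveEjacobian _ df) mulmxK.
  by rewrite -mulmxBl (opprB _ ('d f a _)).
rewrite (le_trans (Mk _))// normrN.
rewrite (le_trans (ler_wpM2l (ltW k0) fxa))//.
rewrite (le_trans (ler_wpM2l (ltW k0) (ler_wpM2l (ltW ek0) (fc _ _ Ux Ua))))//.
set N := `|f x - f a|; suff -> : k * (e / (k * c) * (c * N)) = e * N by [].
by field; rewrite !gt_eqF.
Unshelve. all: by end_near. Qed.

(** The derivative [v *m invmx ('J f (g z))] of [g] costs one order of [f], in
    ['J], but none of [g]: this is what makes the induction work. *)
Lemma Ck_local_inverse (R : realType) d n (U : set 'rV[R]_d)
    (f g : 'rV[R]_d -> 'rV[R]_d) (c : R) :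
  open U -> open (f @` U) -> (forall x, U x -> g (f x) = x) -> 0 < c ->
  (forall x x', U x -> U x' -> `|x - x'| <= c * `|f x - f x'|) ->
  (forall x, U x -> 'J f x \in unitmx) ->
  Ck 1 U f -> Ck n U f -> Ck n (f @` U) g.
Proof.
move=> oU oV gf c0 fc uJ [df _].
have dg z : (f @` U) z ->
    is_diff z g (mulmxr (invmx ('J f (g z)))).
  move=> [x Ux <-]; rewrite gf//.
  exact: is_diff_inverse oV gf c0 fc Ux (df _ Ux) (uJ _ Ux).
elim: n => [|n IHn] Cf.
  by move=> z /dg[dgz _]; exact: differentiable_continuous.
split=> [z /dg[]//|v].
have Cg := IHn (CkS Cf).
have CJ i j : Ck n (f @` U) (fun z => ('J f (g z)) i j).
  apply: (Ck_comp_scalar (W' := U)) (Ck_jacobian _ _ oU Cf) => //.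
  by move=> _ [x Ux <-]; rewrite gf.
have CI i j : Ck n (f @` U) (fun z => invmx ('J f (g z)) i j).
  by apply: Ck_invmx CJ i j => // _ [x Ux <-]; rewrite gf//; exact: uJ.
apply: (Ck_row oV) => j.
have := @Ck_sum R _ _ oV R n _ (index_enum 'I_d) xpredT
  (fun i z => v 0 i * invmx ('J f (g z)) i j).
move=> /(_ (fun i _ => CkM oV (Ck_cst _ _ (v 0 i : R)) (CI i j))).
apply: Ck_eq => // z /dg[dgz E].
by rewrite deriveE// E/= mxE.
Qed.

(** The contraction principle asks for the norm and completeness in a single
    structure. *)
HB.instance Definition _ (R : realType) m n :=
  Uniform_isComplete.Build 'M[R]_(m, n) (@cauchy_cvg _).

(** The equation [x - p x = w] is the fixed point equation of the contraction
    [x |-> p x + w]; the bound on [w] makes this map preserve the closed ball of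
    radius [r], half of [r] being consumed by [p] and half by [w]. *)
Lemma perturbed_identity_surj (R : realType) d (p : 'rV[R]_d -> 'rV[R]_d)
    (a w : 'rV[R]_d) (r : R) :
  0 < r ->
  (forall x x', `|x - a| <= r -> `|x' - a| <= r ->
     `|p x - p x'| <= 2^-1 * `|x - x'|) ->
  `|w - (a - p a)| <= 2^-1 * r ->
  exists2 x, `|x - a| <= r & x - p x = w.
Proof.
move=> r0 pc wa.
pose B := closed_ball_ Num.norm a r; pose T x := p x + w.
have BE x : B x = (`|x - a| <= r) :> Prop by rewrite /B/closed_ball_/= distrC.
have TB : {homo T : x / B x >-> B x}.
  move=> x; rewrite !BE => xr.
  rewrite /T (_ : _ - a = (p x - p a) + (w - (a - p a))); last first.
    by rewrite opprB addrACA addKr.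
  rewrite (le_trans (ler_normD _ _))//.
  have ar : `|a - a| <= r by rewrite subrr normr0 ltW.
  have := pc _ _ xr ar; lra.
have ctrT : is_contraction (mkfun TB).
  exists (2^-1)%:nng; split => /=; first by rewrite invf_lt1 ?ltr1n.
  move=> [x x'] /= []; rewrite !BE => xr x'r.
  by rewrite /T opprD addrACA subrr addr0; exact: pc.
have [||x Bx xE] := banach_fixed_point ctrT.
- exact: closed_closed_ball_.
- by exists a; rewrite BE subrr normr0 ltW.
- exists x; first by rewrite -BE.
  by rewrite {1}xE /= /T addrAC subrr add0r.
Qed.

Lemma segment_in_ball (R : realType) (V : normedModType R) (y a b : V)
    (r t : R) :
  0 <= t <= 1 -> ball y r a -> ball y r b -> ball y r (a + t *: (b - a)).
Proof.
move=> /andP[t0 t1]; rewrite -!ball_normE/= => ya yb.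
have -> : y - (a + t *: (b - a)) = (1 - t) *: (y - a) + t *: (y - b).
  rewrite scalerBl scale1r -addrA [- _ + _]addrC -scalerBr opprB.
  by rewrite [_ + (a - y)]addrC subrKA opprD addrA -scalerN opprB.
rewrite (le_lt_trans (ler_normD _ _))// !normrZ !ger0_norm ?subr_ge0//.
have [ab|ba] := leP `|y - a| `|y - b|.
  by apply: le_lt_trans yb; nra.
by apply: le_lt_trans ya; nra.
Qed.

(** The derivative of [p] at [x] is multiplication by [1 - 'J f x *m M], a
    matrix whose entries are continuous in [x] and vanish at [y]. *)
Lemma near_small_derivative (R : realType) d (V : set 'rV[R]_d)
    (f : 'rV[R]_d -> 'rV[R]_d) (y : 'rV[R]_d) :
  open V -> V y -> Ck 1 V f -> 'J f y \in unitmx ->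
  let p x := x - f x *m invmx ('J f y) in
  \forall x \near y, [/\ V x, 'J f x \in unitmx, differentiable p x &
    forall v, `|'D_v p x| <= 2^-1 * `|v|].
Proof.
move=> oV Vy Cf uJ p; set M := invmx _ in p *.
have df := Cf.1; have CJ i j := Ck_jacobian i j oV Cf.
pose N x := 1%:M - 'J f x *m M.
have CN i j : Ck 0 V (fun x => N x i j).
  have C1 : Ck 0 V (fun x => \sum_k ('J f x) i k * M k j).
    by apply: Ck_sum => // k _; apply: CkM => //; exact: (Ck_cst _ _ (M k j)).
  have C2 := CkM oV (Ck_cst 0 V (-1 : R)) C1.
  apply: Ck_eq (CkD oV (Ck_cst 0 V (1%:M i j : R)) C2) => // x _.
  by rewrite /N !mxE/= mulN1r.
pose S x := \sum_i \sum_j `|N x i j|.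
have CS : Ck 0 V S.
  apply: Ck_sum => // i _; apply: Ck_sum => // j _ x Vx.
  apply: (@continuous_comp _ _ _ (fun x => N x i j) (fun t : R => `|t|)).
    exact: CN.
  exact: norm_continuous.
have Sy : S y = 0.
  rewrite /S big1// => i _; rewrite big1// => j _.
  by rewrite /N mulmxV// subrr mxE normr0.
have Cdet : Ck 0 V (fun x => \det ('J f x)) by exact: Ck_det.
have duJ : \det ('J f y) != 0 by rewrite -unitfE -unitmxE.
near=> x.
have Vx : V x by near: x; exact: open_nbhs_nbhs.
have [did Ed] := is_diff_id x.
have dL := linear_differentiable (f x) (@continuous_mulmxr R d d M).
have dM := differentiable_comp (df _ Vx) dL.
have dp : differentiable p x := differentiableB did dM.
split; [exact: Vx| |exact: dp|move=> v].
  rewrite unitmxE unitfE; near: x.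
  exact: (cvgr_neq0 _ (Cdet y Vy) duJ).
have -> : 'D_v p x = v *m N x.
  (* The chain of equalities is given as terms: rewriting with the rules of
     differentiation makes unification unfold the differentials. *)
  have E1 := congr1 (@^~ v) (diffB did dM).
  have E2 := congr1 (@^~ v) (diff_comp (df _ Vx) dL).
  have E3 := congr1 (@^~ ('d f x v))
    (diff_lin (f x) (@continuous_mulmxr R d d M)).
  have E4 := congr2 (fun u w => u - w) (congr1 (@^~ v) Ed) (etrans E2 E3).
  apply: (etrans (deriveE v dp)); apply: (etrans E1); apply: (etrans E4).
  rewrite /N mulmxBr mulmx1 mulmxA -(deriveEjacobian _ (df _ Vx)).
  by rewrite (deriveE _ (df _ Vx)).
rewrite (le_trans (mulmx_norm_le _ _))// ler_wpM2r//.
have S0 : S x < 2^-1.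
  near: x; apply: (cvgr_lt _ (CS y Vy)); by rewrite Sy invr_gt0.
exact: ltW.
Unshelve. all: by end_near. Qed.

(** The Lipschitz bound says both that [f] is injective on [U] and that its
    inverse is Lipschitz, without naming the inverse. *)
Theorem inverse_function (R : realType) d (V : set 'rV[R]_d)
    (f : 'rV[R]_d -> 'rV[R]_d) (y : 'rV[R]_d) :
  open V -> V y -> Ck 1 V f -> 'J f y \in unitmx ->
  exists U c, [/\ open_nbhs y U /\ U `<=` V,
    forall x, U x -> 'J f x \in unitmx,
    open (f @` U),
    0 < c &
    forall x x', U x -> U x' -> `|x - x'| <= c * `|f x - f x'|].
Proof.
move=> oV Vy Cf uJ; have := near_small_derivative oV Vy Cf uJ.
set p := fun x => x - _; set M := invmx _ in p *.
move=> /nbhs_ballP[r /= r0 yr].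
have pc x x' : ball y r x -> ball y r x' -> `|p x - p x'| <= 2^-1 * `|x - x'|.
  move=> xr x'r; apply: mean_value_inequality => t t01.
  have /yr[_ _ dp pt] : ball y r (x' + t *: (x - x')).
    exact: segment_in_ball.
  by split; [exact: dp|exact: pt].
have [k k0 Mk] := mulmx_bound M.
have pf x x' : x - x' = (p x - p x') + (f x - f x') *m M.
  by rewrite /p mulmxBl opprB addrACA subrK [_ - x' - _]addrAC subrr add0r.
(* [|x - x'| <= |x - x'| / 2 + k |f x - f x'|] gives the constant [2 * k]. *)
exists (ball y r), (2 * k); split.
- split; last by move=> x /yr[].
  by split; [exact: ball_open|exact: ballxx].
- by move=> x /yr[].
(* A value close to [f a] is attained in a closed ball around [a]; its radius is
   [s / 2] so that it stays inside the open ball [ball a s]. *)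
- rewrite openE => _ [a ar <-].
  have /nbhs_ballP[s /= s0 asr] : nbhs a (ball y r).
    by apply: open_nbhs_nbhs; split => //; exact: ball_open.
  have s20 : 0 < s / 2 by rewrite divr_gt0.
  apply/nbhs_ballP; exists (s / 4 / k) => /=.
    by rewrite !divr_gt0.
  move=> z; rewrite -{1}ball_normE/= => zs.
  have as2 x : `|x - a| <= s / 2 -> ball y r x.
    move=> xa; apply: asr; rewrite -ball_normE/= distrC; lra.
  have [||x xa xE] := @perturbed_identity_surj R d p a (z *m M) (s / 2) s20.
  + by move=> x x' /as2 xr /as2 x'r; exact: pc.
  + rewrite /p opprB [a - _ - a]addrAC subrr add0r -mulmxBl (le_trans (Mk _))//.
    rewrite distrC -ler_pdivlMl// (le_trans (ltW zs))// [leLHS]mulrC.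
    by rewrite ler_pM2l ?invr_gt0//; lra.
  exists x; first exact: as2.
  move: xE; rewrite /p opprB addrCA subrr addr0 => /(congr1 (mulmxr ('J f y))).
  by rewrite /= !mulmxKV.
- by rewrite mulr_gt0.
- move=> x x' xr x'r; have := pc _ _ xr x'r; have := Mk (f x - f x').
  have := ler_normD (p x - p x') ((f x - f x') *m M); rewrite -pf; lra.
Qed.

(** * Regularity classes on open and on arbitrary sets *)

Lemma CnE (R : realType) d n (W : set 'rV[R]_d) (f : 'rV[R]_d -> 'rV[R]_d) :
  Cn n W f <-> Ck n W f.
Proof.
elim: n f => [//|n IHn] f.
by split=> -[df Cf]; split => // v; apply/IHn; exact: Cf.
Qed.

Lemma Cr_open_sub (R : realType) d r (W W' : set 'rV[R]_d)
    (f : 'rV[R]_d -> 'rV[R]_d) :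
  W' `<=` W -> Cr_open r W f -> Cr_open r W' f.
Proof.
move=> WW'; case: r => [n|] Cf; last move=> n.
  by apply/CnE; apply: Ck_sub WW' _; exact/CnE.
by apply/CnE; apply: Ck_sub WW' _; apply/CnE; exact: Cf.
Qed.

Lemma Cr_open_continuous (R : realType) d r (W : set 'rV[R]_d)
    (f : 'rV[R]_d -> 'rV[R]_d) :
  Cr_open r W f -> forall x, W x -> {for x, continuous f}.
Proof.
case: r => [n /CnE|/(_ 0%N) Cf]; first exact: Ck_continuous.
exact: Cf.
Qed.

Lemma Cr_open_comp (R : realType) d r (W W' : set 'rV[R]_d)
    (f g : 'rV[R]_d -> 'rV[R]_d) :
  open W -> open W' -> (forall x, W x -> W' (f x)) ->
  Cr_open r W f -> Cr_open r W' g -> Cr_open r W (g \o f).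
Proof.
move=> oW oW' WW'; have CnC n : Cn n W f -> Cn n W' g -> Cn n W (g \o f).
  by move=> /CnE Cf /CnE Cg; apply/CnE; exact: Ck_comp WW' Cf Cg.
by case: r => [n|] Cf Cg; [exact: CnC|move=> n; exact: CnC].
Qed.

Lemma open_preimage (R : realType) d (W W' : set 'rV[R]_d)
    (f : 'rV[R]_d -> 'rV[R]_d) :
  open W -> (forall x, W x -> {for x, continuous f}) -> open W' ->
  open (W `&` f @^-1` W').
Proof.
move=> oW cf oW'; rewrite openE => x [Wx W'fx].
apply: filterI; first exact: open_nbhs_nbhs.
by apply: (cf x Wx); exact: open_nbhs_nbhs.
Qed.

Lemma Cr_on_open (R : realType) d r (D : set 'rV[R]_d)
    (f : 'rV[R]_d -> 'rV[R]_d) :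
  open D -> Cr_open r D f -> Cr_on r D f.
Proof.
move=> oD Cf.
have ext x : D x -> exists W F,
    [/\ open_nbhs x W, Cr_open r W F & forall z, D z -> W z -> F z = f z].
  by exists D, f.
case: r Cf ext => [[|n]|] //= Cf _.
by apply: continuous_in_subspaceT => x /[!inE]; exact: Cf.
Qed.

Lemma within_continuous_comp (T1 T2 T3 : topologicalType) (A : set T1)
    (B : set T2) (f : T1 -> T2) (g : T2 -> T3) :
  (forall x, A x -> B (f x)) -> {within A, continuous f} ->
  {within B, continuous g} -> {within A, continuous (g \o f)}.
Proof.
move=> AB /subspace_continuousP cf /subspace_continuousP cg.
apply/subspace_continuousP => x Ax N Nx.
have fN : nbhs x [set z | A z -> B (f z) -> N (g (f z))].
  exact: cf x Ax _ (cg _ (AB _ Ax) N Nx).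
by apply: filterS fN => z fN Az; exact: fN Az (AB z Az).
Qed.

(** The intermediate set is [B] rather than an open set: the local extension [G]
    of [g] is composed with the local extension [F] of [f] on the open set where
    this makes sense, and both agree with [g] and [f] on [B] and [A]. *)
Lemma Cr_on_comp (R : realType) d r (A B : set 'rV[R]_d)
    (f g h : 'rV[R]_d -> 'rV[R]_d) :
  (forall x, A x -> B (f x)) -> (forall x, A x -> h x = (g \o f) x) ->
  Cr_on r A f -> Cr_on r B g -> Cr_on r A h.
Proof.
move=> AB hgf.
have comp_ext : (forall x, A x -> exists W F,
      [/\ open_nbhs x W, Cr_open r W F & forall z, A z -> W z -> F z = f z]) ->
    (forall x, B x -> exists W F,
      [/\ open_nbhs x W, Cr_open r W F & forall z, B z -> W z -> F z = g z]) ->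
    forall x, A x -> exists W F,
      [/\ open_nbhs x W, Cr_open r W F & forall z, A z -> W z -> F z = h z].
  move=> Cf Cg x Ax.
  have [W [F [[oW Wx] CF Ff]]] := Cf x Ax.
  have [W' [G [[oW' W'fx] CG Gg]]] := Cg _ (AB x Ax).
  have oI := open_preimage oW (Cr_open_continuous CF) oW'.
  exists (W `&` F @^-1` W'), (G \o F); split.
  - by split => //; split => //=; rewrite Ff.
  - apply: (Cr_open_comp (W' := W')) => //; first by move=> ? [].
    by apply: Cr_open_sub CF; exact: subIsetl.
  - move=> z Az [Wz W'z]; rewrite hgf//= -Ff//; apply: Gg => //.
    by rewrite Ff//; exact: AB.
case: r comp_ext => [[|n]|] //= _ cf cg.
have hE : {in A, g \o f =1 h} by move=> x /[!inE] Ax; rewrite hgf.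
by apply: subspace_eq_continuous hE _; exact: within_continuous_comp AB cf cg.
Qed.

(** * Local inverses and the conjugacy *)

(** One local inverse serves for every order of regularity: its domain is
    determined by the first derivative alone. *)
Lemma inverse_function_Cn (R : realType) d (V : set 'rV[R]_d)
    (f : 'rV[R]_d -> 'rV[R]_d) (y : 'rV[R]_d) :
  open_nbhs y V -> Cr_open (Some 1%N) V f -> 'J f y \in unitmx ->
  exists U g, [/\ open_nbhs y U /\ U `<=` V, local_inverse U f g, open (f @` U)
    & forall r, Cr_open r V f -> Cr_open r (f @` U) g].
Proof.
move=> [oV Vy] /CnE C1 uJ.
have [U [c [[oU UV] UJ oW c0 fc]]] := inverse_function oV Vy C1 uJ.
pose g z := xget y [set x | U x /\ f x = z].
have gf : local_inverse U f g.
  move=> u Uu; have [Ug fg] := @xgetPex _ y [set x | U x /\ f x = f u]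
    (ex_intro _ u (conj Uu erefl)).
  apply/eqP; rewrite -subr_eq0 -normr_le0 (le_trans (fc _ _ Ug Uu))//.
  by rewrite fg subrr normr0 mulr0.
exists U, g; split => //.
have CW n : Cn n V f -> Cn n (f @` U) g.
  move=> /CnE Cf; apply/CnE.
  apply: (Ck_local_inverse oU.1 oW gf c0 fc UJ); exact: Ck_sub UV _.
by move=> [n|] Cf; [exact: CW|move=> n; exact: CW].
Qed.

(** By the chain rule the two Jacobians multiply to the identity; for square
    matrices a one-sided inverse suffices. *)
Lemma jacobian_unit_of_left_inverse (R : realType) d
    (f g : 'rV[R]_d -> 'rV[R]_d) (y : 'rV[R]_d) :
  differentiable f y -> differentiable g (f y) ->
  {near y, g \o f =1 id} -> 'J f y \in unitmx.
Proof.
move=> df dg gf.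
have J1 : 'J f y *m 'J g (f y) = 1%:M; last exact: (mulmx1_unit J1).1.
apply/row_matrixP => i; rewrite !rowE mulmxA -(deriveEjacobian _ df).
rewrite -(deriveEjacobian _ dg) mulmx1.
have [dgf Egf] := is_diff_comp (differentiableP df) (differentiableP dg).
have := near_eq_derive (delta_mx 0 i) gf.
rewrite derive_id (deriveE _ dgf) Egf /=.
by rewrite (deriveE _ df) (deriveE _ dg).
Qed.

(** [A] is the part of [X] that [h] sends into [U]. *)
Lemma inverse_formula (R : realType) d (X Y : set 'rV[R]_d)
    (h G1 G2 : 'rV[R]_d -> 'rV[R]_d) (y : 'rV[R]_d)
    (U : set 'rV[R]_d) (Ginv : 'rV[R]_d -> 'rV[R]_d) :
  homeomorphism_between X Y h -> (forall x, X x -> G1 x = G2 (h x)) ->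
  Y y -> open_nbhs y U -> local_inverse U G2 Ginv ->
  exists A, inverse_formula_on X h G1 G2 y U Ginv A /\
    forall r, Cr_on r A G1 -> Cr_on r (G2 @` U) Ginv -> Cr_on r A h.
Proof.
move=> [k [[_ kX] _ hk ch _]] G12 Yy [oU Uy] invG.
have /open_subspaceP[Z oZ ZE] : open (h @^-1` U : set (subspace X)).
  by move/continuousP: ch; apply.
have AE x : (X `&` Z) x -> X x /\ U (h x).
  move=> [Xx Zx]; split => //.
  by have [] : (h @^-1` U `&` X) x by rewrite -ZE.
have formula x : (X `&` Z) x ->
    [/\ U (h x), (G2 @` U) (G1 x) & h x = (Ginv \o G1) x].
  move=> /AE[Xx Uhx]; rewrite /= G12// invG//; split => //.
  by exists (h x).
exists (X `&` Z); split.
  split => //; first by exists Z.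
  exists (k y); last by rewrite hk.
  split; first exact: kX.
  have [] : (Z `&` X) (k y) by rewrite ZE; split; [rewrite /= hk|exact: kX].
  by [].
move=> r CG1 Cinv; apply: Cr_on_comp CG1 Cinv => x /formula[] //.
Qed.

Theorem corollary2 (R : realType) (d : nat) (X Y : set 'rV[R]_d)
  (S1 S2 : R -> 'rV[R]_d -> 'rV[R]_d) (h : 'rV[R]_d -> 'rV[R]_d)
  (lam : 'I_d -> R) (g1 g2 : 'I_d -> 'rV[R]_d -> R)
  (flow1 : flow_on X S1) (flow2 : flow_on Y S2)
  (equiv_h : orbit_equivalent X Y S1 S2 h)
  (lam_neq0 : forall i, lam i != 0)
  (eigen1 : forall i, koopman_eigenfunction X S1 (lam i) (g1 i))
  (eigen2 : forall i, koopman_eigenfunction Y S2 (lam i) (g2 i))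
  (matched : componentwise_matched X h g1 g2)
  (y : 'rV[R]_d) (Yy : Y y) :
  let G1 := vector_valued g1 in
  let G2 := vector_valued g2 in
  [/\ (invertible_around G2 y \/ jacobian_nonsingular_at G2 y ->
         componentwise_matched_complete_set X Y S1 S2 h lam g1 g2 y),
      (forall V, open_nbhs y V -> Cr_open (Some 1%N) V G2 ->
         ('J G2 y \in unitmx <->
          exists U Ginv, [/\ open_nbhs y U, local_inverse U G2 Ginv
                           & Cr_on (Some 1%N) (G2 @` U) Ginv])),
      (forall U Ginv, open_nbhs y U -> local_inverse U G2 Ginv ->
         exists A, inverse_formula_on X h G1 G2 y U Ginv A /\
           forall r, Cr_on r A G1 -> Cr_on r (G2 @` U) Ginv -> Cr_on r A h)
    & (forall V, open_nbhs y V -> Cr_open (Some 1%N) V G2 ->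
         'J G2 y \in unitmx ->
         exists U Ginv A,
           [/\ open_nbhs y U /\ U `<=` V, local_inverse U G2 Ginv,
               inverse_formula_on X h G1 G2 y U Ginv A
             & forall r, Cr_on r A G1 -> Cr_open r V G2 -> Cr_on r A h])].
Proof.
move=> G1 G2.
have G12 x : X x -> G1 x = G2 (h x).
  by move=> Xx; apply/rowP => i; rewrite !mxE; exact: matched.
have homeo := equiv_h.1.
split.
- move=> inv; split => //; split => //.
  case: inv => // -[[V [Vy C1]] uJ].
  have [U [Ginv [[Uy _] invG _ _]]] := inverse_function_Cn Vy C1 uJ.
  by exists U, Ginv.
- move=> V Vy C1; split=> [uJ|[U [Ginv [Uy invG CG]]]].
    have [U [Ginv [[Uy _] invG oGU CG]]] := inverse_function_Cn Vy C1 uJ.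
    by exists U, Ginv; split => //; apply: Cr_on_open => //; exact: CG.
  (* [F] extends [Ginv] near [G2 y], hence is a differentiable left inverse. *)
  have [W [F [[oW WGy] [dF _] FG]]] := CG _ (imageP G2 Uy.2).
  have dG2 : differentiable G2 y by case: C1 => dG _; exact: dG Vy.2.
  apply: (jacobian_unit_of_left_inverse dG2 (dF _ WGy)).
  near=> x.
  have Ux : U x by near: x; exact: open_nbhs_nbhs.
  rewrite /= FG; [exact: invG|exact: imageP|].
  by near: x; apply: (differentiable_continuous dG2); exact: open_nbhs_nbhs.
- by move=> U Ginv Uy invG; exact: inverse_formula homeo G12 Yy Uy invG.
- move=> V Vy C1 uJ.
  have [U [Ginv [[Uy UV] invG oGU CG]]] := inverse_function_Cn Vy C1 uJ.
  have [A [formula CA]] := inverse_formula homeo G12 Yy Uy invG.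
  exists U, Ginv, A; split => // r CG1 CG2.
  by apply: CA => //; apply: Cr_on_open => //; exact: CG.
Unshelve. all: by end_near. Qed.
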